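(* Let $n \ge 1$ and let $h = \{ x \in \mathbb{R}^n : \sum_{i=1}^n c_i x_i = 1 \}$ be an affine hyperplane in $\mathbb{R}^n$ (with real coefficients $c_1,\dots,c_n$, not all zero), so that $h$ does not pass through the origin. If the coefficients satisfy (i) $c_i \le 1$ for all $i$, (ii) $\sum_{i=1}^n c_i \ge 1$, and (iii) $c_i \in \mathbb{Z}$ for all $i$, then $w(h) = 1$. Otherwise, $w(h) \le 1 - \frac{1}{n}$.
   Context: Let $Q^n = \{0,1\}^n$. For a nonzero point $x \in Q^n$ with exactly $t$ coordinates equal to $1$, its weight is $w(x) = \frac{1}{t\binom{n}{t}}$. For a set $S \subseteq \mathbb{R}^n$, its weight is $w(S) = \sum_{p \in S \cap Q^n} w(p)$ (for a set avoiding the origin, only nonzero points of $Q^n$ occur). *)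

(* Defs.v *)
From HB Require Import structures.
From mathcomp Require Import all_boot all_order all_algebra.
From mathcomp Require Import all_classical all_reals.

Set Implicit Arguments.
Unset Strict Implicit.
Unset Printing Implicit Defensive.

Import Order.TTheory GRing.Theory Num.Theory.

Local Open Scope classical_set_scope.
Local Open Scope ring_scope.

Definition cube (R : realType) (n : nat) : set 'rV[R]_n :=
  [set x : 'rV[R]_n | forall i, x 0 i = 0 \/ x 0 i = 1].
Arguments cube : clear implicits.

(* At x = 0 the weight is not meaningful; since 0^-1 = 0, it evaluates to 0. *)
Definition point_weight (R : realType) (n : nat) (x : 'rV[R]_n) : R :=
  let t := #|[set i | x 0 i == 1]%SET| in (t * 'C(n, t))%:R^-1.

(* The cube is finite, so this finitely supported sum is the ordinary one. *)
Definition weight (R : realType) (n : nat) (S : set 'rV[R]_n) : R :=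
  \sum_(p \in S `&` cube R n) point_weight p.

Definition hyperplane (R : realType) (n : nat) (c : 'rV[R]_n) : set 'rV[R]_n :=
  [set x : 'rV[R]_n | \sum_(i < n) c 0 i * x 0 i = 1].

(* Main.v *)
Require Import Defs.
From mathcomp Require Import all_boot all_order all_fingroup all_algebra.
From mathcomp Require Import all_classical all_reals.
From mathcomp Require Import zify lra.

Set Implicit Arguments.
Unset Strict Implicit.

Import Order.TTheory GRing.Theory Num.Theory.
Local Open Scope classical_set_scope.
Local Open Scope ring_scope.

(* Put the coefficients in a uniformly random order and look at prefix sums. A
   t-subset A is the set of the first t entries with probability 1 / 'C(n, t),
   so n`! w(h) is the sum over orders and over t of [t-th prefix sum = 1] / t.
   The factor 1 / t is absorbed by rotating the first t entries: by the cycle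
   lemma, among the t rotations of a block of sum 1, counting those whose
   proper prefix sums are all < 1 plus those whose proper prefix sums are all
   <= 0 gives at least 2. In the integer case exactly one rotation has its
   proper prefix sums < 1. Hence 2 w(h) is at most the expected number of
   passages, i.e. [first prefix sum >= 1 is 1] + [first prefix sum > 0 is 1];
   in the admissible case w(h) is the probability that the first prefix sum
   >= 1 is 1, which is certain since the steps are integers <= 1 with sum >= 1.
   Otherwise, average over the n rotations of the whole order: either some
   rotation has no passage, or two rotations have at most one, or every
   rotation has two; in the last case all coefficients are integers. *)

(** * Prefix sums, rotations and the cycle lemma *)

Section Sequences.
Variable R : archiRealFieldType.
Implicit Types (u : nat -> R) (n t : nat).

Definition psum u j : R := \sum_(i < j) u i.

Definition cyc n u : nat -> R := fun i => u (i %% n)%N.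

Definition shift n k u : nat -> R := fun i => u ((k + i) %% n)%N.

(** Only proper prefixes are tested: if prefix sum [t] is 1, then [good] makes [t] the first time at
    level 1 or more, and [good0] the first time above level 0. *)
Definition good t u : bool := [forall j : 'I_t, psum u j < 1].

Definition good0 t u : bool := [forall j : 'I_t, psum u j <= 0].

Lemma goodP t u : reflect (forall j, (j < t)%N -> psum u j < 1) (good t u).
Proof.
by apply: (iffP forallP) => [H j jt|H j]; [exact: (H (Ordinal jt)) | exact: H].
Qed.

Lemma good0P t u : reflect (forall j, (j < t)%N -> psum u j <= 0) (good0 t u).
Proof.
by apply: (iffP forallP) => [H j jt|H j]; [exact: (H (Ordinal jt)) | exact: H].
Qed.

Lemma good0_good t u : good0 t u -> good t u.
Proof.
by move=> /good0P H; apply/goodP => j /H /le_lt_trans; apply; exact: ltr01.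
Qed.

Lemma psum0 u : psum u 0 = 0.
Proof. exact: big_ord0. Qed.

Lemma psumS u j : psum u j.+1 = psum u j + u j.
Proof. exact: big_ord_recr. Qed.

Lemma eq_psum u v j : (forall i, (i < j)%N -> u i = v i) -> psum u j = psum v j.
Proof. by move=> uv; apply: eq_bigr => i _; exact: uv. Qed.

Lemma psum_shift n k u j :
  psum (shift n k u) j = psum (cyc n u) (k + j) - psum (cyc n u) k.
Proof. by rewrite /psum big_split_ord /= [RHS]addrC addKr. Qed.

Lemma psum_cyc n u j : (j <= n)%N -> psum (cyc n u) j = psum u j.
Proof.
by move=> jn; apply: eq_psum => i ij; rewrite /cyc modn_small// (leq_trans ij).
Qed.

Lemma psum_cycD n u k :
  psum (cyc n u) (k + n) = psum (cyc n u) k + psum u n.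
Proof.
elim: k => [|k IH]; first by rewrite psum0 add0r add0n psum_cyc.
by rewrite addSn !psumS IH /cyc modnDr addrAC.
Qed.

Lemma psum_shift_period n k u : psum (shift n k u) n = psum u n.
Proof. by rewrite psum_shift psum_cycD [LHS]addrC addKr. Qed.

Lemma shift_mod n k u : shift n (k %% n) u = shift n k u.
Proof. by apply/funext => i; rewrite /shift modnDml. Qed.

Lemma first_argmax (Q : nat -> R) n : (0 < n)%N ->
  exists k, [/\ (k < n)%N, forall j, (j < n)%N -> Q j <= Q k
                & forall j, (j < k)%N -> Q j < Q k].
Proof.
elim: n => // -[_ _|n /(_ isT) [k [kn kmax kfirst]] _].
  by exists 0%N; split => // -[].
have [lt|le] := ltP (Q k) (Q n.+1).
  exists n.+1; split=> // j; rewrite ltnS.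
    by rewrite leq_eqVlt => /predU1P[->//|/kmax /le_trans]; apply; exact: ltW.
  by move=> /kmax /le_lt_trans; apply.
exists k; split => //; first by rewrite ltnW.
by move=> j; rewrite ltnS leq_eqVlt => /predU1P[->//|/kmax].
Qed.

Lemma good_shift t k u : psum u t = 1 ->
  reflect (forall j, (j < t)%N -> psum (cyc t u) (k + j) < psum (cyc t u) k + 1)
          (good t (shift t k u)).
Proof.
move=> ut; apply: (iffP (goodP _ _)) => H j /H;
  by rewrite psum_shift ltrBlDl.
Qed.

(** Before wrap-around, sums stay at most the maximum. After it they are raised by 1, but come from
    positions left of [k], where sums lie strictly below the maximum. *)
Lemma first_argmax_good t u k : psum u t = 1 -> (k < t)%N ->
  (forall j, (j < t)%N -> psum (cyc t u) j <= psum (cyc t u) k) ->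
  (forall j, (j < k)%N -> psum (cyc t u) j < psum (cyc t u) k) ->
  good t (shift t k u).
Proof.
move=> ut kt kmax kfirst; apply/good_shift => // j jt.
have [lt|le] := ltnP (k + j) t; first by have := kmax _ lt; lra.
have -> : (k + j = (k + j - t) + t)%N by rewrite subnK.
rewrite psum_cycD ut.
have /kfirst : (k + j - t < k)%N by lia.
by lra.
Qed.

(** The rotation at the leftmost maximum is good. Either it satisfies [good0] too and counts twice,
    or it leads to a second good rotation. *)
Lemma cycle_lemma t u : (0 < t)%N -> psum u t = 1 ->
  (2 <= \sum_(k < t) (good t (shift t k u) + good0 t (shift t k u)))%N.
Proof.
move=> t0 ut; have [k [kt kmax kfirst]] := first_argmax (psum (cyc t u)) t0.
have gk := first_argmax_good ut kt kmax kfirst.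
rewrite (bigD1 (Ordinal kt)) //= gk.
have [//|/forallPn ng0] := boolP (good0 t (shift t k u)).
(* The first later position whose prefix sum exceeds the one at k also starts
   a good rotation. *)
have /ex_minnP[j /andP[jt jpos] jmin] :
    exists j, (j < t)%N && (0 < psum (shift t k u) j).
  by case: ng0 => j; rewrite -ltNge => ?; exists j; rewrite ltn_ord.
rewrite psum_shift subr_gt0 in jpos.
have j0 : (0 < j)%N by case: j jpos {jt jmin} => //; rewrite addn0 ltxx.
have jfirst i : (i < j)%N -> psum (cyc t u) (k + i) <= psum (cyc t u) k.
  move=> ij; rewrite leNgt; apply/negP => lt; have := jmin i.
  by rewrite psum_shift subr_gt0 lt (ltn_trans ij jt) leqNgt ij => /(_ isT).
move/(good_shift _ ut) : gk => gk.
have gj : good t (shift t (k + j) u).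
  apply/good_shift => // i it.
  (* Before wrapping past [k + t], goodness at [k] bounds the sum; after that, the minimality of [j]
     does. *)
  have := gk _ jt; have [lt|le] := ltnP (j + i) t.
    by have := gk _ lt; rewrite addnA; lra.
  have -> : (k + j + i = (k + (j + i - t)) + t)%N by lia.
  rewrite psum_cycD ut.
  have /jfirst : (j + i - t < j)%N by lia.
  by lra.
have k't : ((k + j) %% t < t)%N by rewrite ltn_mod.
rewrite (bigD1 (Ordinal k't)) /=; first by rewrite shift_mod gj; lia.
rewrite -val_eqE /=; apply/eqP => e.
have : (k + j = k + 0 %[mod t])%N by rewrite e addn0 modn_small.
by move/eqP; rewrite eqn_modDl mod0n modn_small// => /eqP j00; rewrite j00 in j0.
Qed.

Lemma int_lt1 (x : R) : x \is a Num.int -> (x < 1) = (x <= 0).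
Proof. by move=> /intrP[m ->]; rewrite ltrz1 lerz0; lia. Qed.

Lemma psum_int n u j : (forall i, (i < n)%N -> u i \is a Num.int) ->
  (j <= n)%N -> psum u j \is a Num.int.
Proof.
by move=> ui jn; apply: rpred_sum => i _; apply/ui/(leq_trans _ jn).
Qed.

(** For uniqueness, let [a < b] both start good rotations. Integrality turns the bound at [a] into
    sum at [b] <= sum at [a], while the rotation from [b], read at [a + t], gives the opposite
    strict inequality. *)
Lemma cycle_lemma_int t u : (0 < t)%N -> psum u t = 1 ->
  (forall i, (i < t)%N -> u i \is a Num.int) ->
  (\sum_(k < t) good t (shift t k u) = 1)%N.
Proof.
move=> t0 ut ui; have [k [kt kmax kfirst]] := first_argmax (psum (cyc t u)) t0.
have gk := first_argmax_good ut kt kmax kfirst.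
rewrite (bigD1 (Ordinal kt)) //= gk big1 // => i ik; apply/eqP; rewrite eqb0.
have Qi j : psum (cyc t u) j \is a Num.int.
  by apply: rpred_sum => l _; apply: ui; rewrite ltn_mod.
suff H a b : (a < b)%N -> (b < t)%N ->
    good t (shift t a u) -> good t (shift t b u) -> False.
  apply/negP => gi; have := ltn_ord i; move: ik; rewrite -val_eqE /= neq_ltn.
  by case/orP => lt it; [apply: (H _ _ lt kt) | apply: (H _ _ lt it)].
move=> ab bt /(good_shift _ ut) ga /(good_shift _ ut) gb.
have : psum (cyc t u) b - psum (cyc t u) a <= 0.
  have := ga (b - a)%N; rewrite subnKC ?(ltnW ab)// => ha.
  by rewrite -int_lt1 ?rpredB// ltrBlDl; apply: ha; lia.
have := gb (t - (b - a))%N; have -> : (b + (t - (b - a)) = a + t)%N by lia.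
rewrite psum_cycD ut => hb.
have {}hb : psum (cyc t u) a + 1 < psum (cyc t u) b + 1 by apply: hb; lia.
by lra.
Qed.

(** * Passages of a single sequence *)

Lemma first_passage n u (G : nat -> nat) t :
  (forall s, ~~ good s u -> G s = 0%N) ->
  (t < n)%N -> psum u t.+1 = 1 -> good t.+1 u ->
  (\sum_(s < n) (psum u s.+1 == 1%R) * G s.+1 = G t.+1)%N.
Proof.
move=> G0 tn ut gt; rewrite (bigD1 (Ordinal tn)) //= ut eqxx mul1n.
rewrite big1 ?addn0 // => s; rewrite -val_eqE /= neq_ltn => /orP[st|ts].
  have /lt_eqF -> : psum u s.+1 < 1 by move/goodP: gt; exact.
  by rewrite mul0n.
rewrite G0 ?muln0 //; apply/goodP => /(_ t.+1 ts); rewrite ut; lra.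
Qed.

Definition passages n u : nat :=
  (\sum_(s < n) (psum u s.+1 == 1%R) * (good s.+1 u + good0 s.+1 u))%N.

(** At most one [t] contributes: sums before a good hit are below 1, and later prefixes contain the
    sum 1, so are not good. As [good0] implies [good], its contribution is 1 or 2. *)
Variant passages_spec n u : nat -> Prop :=
| NoPassage : (forall t, (t < n)%N -> ~~ ((psum u t.+1 == 1) && good t.+1 u)) ->
    passages_spec n u 0
| Passage t : (t < n)%N -> psum u t.+1 = 1 -> good t.+1 u ->
    passages_spec n u (1 + good0 t.+1 u).

Lemma passagesP n u : passages_spec n u (passages n u).
Proof.
have Good0 s : ~~ good s u -> good0 s u = false.
  by move=> ng; apply: contraNF ng; exact: good0_good.
have [/existsP[t /andP[/eqP ut gt]]|/existsPn H] :=
    boolP [exists t : 'I_n, (psum u t.+1 == 1) && good t.+1 u].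
  rewrite /passages (@first_passage _ _ (fun s => good s u + good0 s u)%N t) //.
    by rewrite gt; exact: Passage.
  by move=> s ng; rewrite (negbTE ng) Good0.
rewrite /passages big1; first by constructor => t tn; exact: (H (Ordinal tn)).
move=> s _; have := H s; rewrite negb_and => /orP[/negbTE -> //|ng].
by rewrite (negbTE ng) Good0 // muln0.
Qed.

Lemma passages_le2 n u : (passages n u <= 2)%N.
Proof. by case: passagesP => // t _ _ _; case: good0. Qed.

(** * Averaging passages over the rotations of an order *)

Lemma sum_deficit n (f : 'I_n -> nat) : (forall i, f i <= 2)%N ->
  (\sum_(i < n) f i + \sum_(i < n) (2 - f i) = 2 * n)%N.
Proof.
move=> f2; rewrite -big_split /= (eq_bigr (fun=> 2)%N) => [|i _].
  by rewrite sum_nat_const card_ord mulnC.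
by rewrite subnKC.
Qed.

(** The bound [1 - 1/n] amounts to a total deficit of 2 from [2 * n]. One value 0 provides it; in
    [sum_le_two1], two values at most 1 do. *)
Lemma sum_le_two0 n (f : 'I_n -> nat) (i : 'I_n) :
  (forall i, f i <= 2)%N -> f i = 0%N -> (\sum_(i < n) f i <= 2 * n.-1)%N.
Proof.
by move=> f2 fi; have := sum_deficit f2; rewrite [X in (_ + X)%N](bigD1 i) //=; lia.
Qed.

Lemma sum_le_two1 n (f : 'I_n -> nat) (i j : 'I_n) :
  (forall i, f i <= 2)%N -> i != j -> (f i <= 1)%N -> (f j <= 1)%N ->
  (\sum_(i < n) f i <= 2 * n.-1)%N.
Proof.
move=> f2 ij fi fj; have := sum_deficit f2.
by rewrite [X in (_ + X)%N](bigD1 i) //= [X in (_ + (_ + X))%N](bigD1 j) 1?eq_sym //=; lia.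
Qed.

(** Starting with the step [u j], the walk jumps over level 1 at once. *)
Lemma rotation_gt1 n u j : (j < n)%N -> u j > 1 -> passages n (shift n j u) = 0%N.
Proof.
move=> jn uj; have sj : psum (shift n j u) 1 = u j.
  by rewrite /psum big_ord1 /shift addn0 modn_small.
case: passagesP => // -[|t] tn ut /goodP gt.
  by exfalso; move: ut; rewrite sj; lra.
by exfalso; have := gt 1%N isT; rewrite sj; lra.
Qed.

(** From a maximum of the prefix sums the walk stays at or below 0 until it wraps around, and then
    gains only [psum u n < 1]. *)
Lemma rotation_lt1 n u : (0 < n)%N -> psum u n < 1 ->
  exists2 k, (k < n)%N & passages n (shift n k u) = 0%N.
Proof.
move=> n0 un; have [k [kn kmax _]] := first_argmax (psum (cyc n u)) n0.
exists k => //; case: passagesP => // t tn ut _; exfalso.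
suff : psum (shift n k u) t.+1 < 1 by lra.
rewrite psum_shift; have [lt|le] := ltnP (k + t.+1) n.
  by have := kmax _ lt; lra.
have -> : (k + t.+1 = (k + t.+1 - n) + n)%N by rewrite subnK.
have : (k + t.+1 - n < n)%N by lia.
by rewrite psum_cycD => /kmax; lra.
Qed.

(** The hypothesis says that from every position the first rise above the current level is by
    exactly 1, which is what two passages in every rotation mean. *)
Lemma ladder_int (Q : nat -> R) :
  (forall k, exists t, Q (k + t.+1)%N = Q k + 1 /\
     forall i, (i < t.+1)%N -> Q (k + i)%N <= Q k) ->
  forall k, Q k.+1 - Q k \is a Num.int.
Proof.
move=> ladder k; have [t [Qt Qi]] := ladder k.
(* Climbing from k.+1 by unit steps reaches k + t.+1, the first position above
   Q k, without jumping over it. *)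
suff H d i : (i + d = t)%N -> Q (k + t.+1)%N - Q (k + i.+1)%N \is a Num.int.
  have -> : Q k.+1 - Q k = 1 - (Q (k + t.+1)%N - Q (k + 1)%N).
    by rewrite addn1; lra.
  by rewrite rpredB ?rpred1 // (H t 0%N).
elim/ltn_ind: d i => -[_ i|d IH i idt].
  by rewrite addn0 => ->; rewrite subrr rpred0.
have Qi1 : Q (k + i.+1)%N <= Q k by apply: Qi; lia.
have [s [Qs Qsi]] := ladder (k + i.+1)%N.
(* Otherwise [Q (k + t.+1)] would be at most [Q (k + i.+1)], hence at most [Q k]. *)
have st : (s < d.+1)%N.
  rewrite ltnNge; apply/negP => ds.
  have := Qsi d.+1; have -> : (k + i.+1 + d.+1 = k + t.+1)%N by lia.
  by move=> /(_ ds); lra.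
have := IH (d - s)%N _ (i + s.+1)%N; rewrite -addSn addnA Qs => H.
have {}H : Q (k + t.+1)%N - (Q (k + i.+1)%N + 1) \is a Num.int by apply: H; lia.
by rewrite -(rpredDr _ (rpredN1 _)) -?addrA -?opprD //; exact: H.
Qed.

Lemma rotation_nonint n u j : (j < n)%N -> u j \isn't a Num.int ->
  (\sum_(k < n) passages n (shift n k u) <= 2 * n.-1)%N.
Proof.
move=> jn uj; have n0 : (0 < n)%N by lia.
have f2 (k : 'I_n) : (passages n (shift n k u) <= 2)%N by exact: passages_le2.
have [[k fk]|nf0] := pselect (exists k : 'I_n, passages n (shift n k u) = 0%N).
  exact: sum_le_two0 fk.
(* Here [k] is any natural number, as [ladder_int] requires; [shift_mod] reduces it below [n]. *)
have pass k : exists t, [/\ (t < n)%N, psum (shift n k u) t.+1 = 1,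
    good t.+1 (shift n k u) &
    passages n (shift n k u) = (1 + good0 t.+1 (shift n k u))%N].
  case fk : _ / (passagesP n (shift n k u)) => [_|t tn ut gt].
    case: nf0; exists (Ordinal (ltn_pmod k n0)) => /=.
    by rewrite shift_mod.
  by exists t.
have [[k fk]|nf1] := pselect (exists k : 'I_n, (passages n (shift n k u) <= 1)%N).
  have [t [tn ut gt ft]] := pass k.
  (* From k the walk visits a height strictly between 0 and 1, at k + i; seen
     from k + i, the hit of level 1 lies strictly between 0 and 1 as well. *)
  move: fk; rewrite ft; case: good0P => // /existsNP[i] /not_implyP[it] /negP.
  rewrite -ltNge psum_shift subr_gt0 => Qi _.
  have i0 : (0 < i)%N by case: i Qi {it} => //; rewrite addn0 ltxx.
  have kin : ((k + i) %% n < n)%N by rewrite ltn_mod.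
  apply: (@sum_le_two1 _ _ k (Ordinal kin)) => //.
  - rewrite -val_eqE /=; apply/eqP => e.
    have : (k + i = k + 0 %[mod n])%N by rewrite -e addn0 modn_small.
    by move/eqP; rewrite eqn_modDl mod0n modn_small; [move=> /eqP i00; rewrite i00 in i0|lia].
  - by rewrite ft; case: good0P => // /(_ i it); rewrite psum_shift; lra.
  rewrite /= shift_mod.
  have [s [sn us gs ->]] := pass (k + i)%N.
  case: good0P => // g0.
  (* The hit from [k + i] is more than 1 above the height at [k], a level not reached up to the hit
     from [k]; so it comes later, and [good0] applies at [t.+1 - i]. *)
  have ts : (t.+1 - i < s.+1)%N.
    rewrite ltnNge; apply/negP => st.
    have : psum (cyc n u) (k + i + s.+1) <= psum (cyc n u) k + 1.
      have : (i + s.+1 <= t.+1)%N by lia.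
      rewrite leq_eqVlt => /predU1P[e|lt].
        by rewrite -addnA e; move: ut; rewrite psum_shift; lra.
      by move/goodP: gt => /(_ _ lt); rewrite psum_shift addnA; lra.
    by move: us; rewrite psum_shift; lra.
  have := g0 _ ts; rewrite psum_shift.
  have -> : (k + i + (t.+1 - i) = k + t.+1)%N by lia.
  have := gt; move/goodP => /(_ _ it); rewrite psum_shift.
  by move: ut; rewrite psum_shift; lra.
(* Every rotation now has two passages, so [good0] holds at each hit and the periodic walk is a
   ladder. *)
case/negP: uj.
have -> : u j = psum (cyc n u) j.+1 - psum (cyc n u) j.
  by rewrite psumS addrC addKr /cyc modn_small.
apply: ladder_int => k; have [t [tn ut gt ft]] := pass k.
exists t; split; first by move: ut; rewrite psum_shift; lra.
move=> i it; have : good0 t.+1 (shift n k u).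
  apply/negPn/negP => ng; apply: nf1; exists (Ordinal (ltn_pmod k n0)) => /=.
  by rewrite shift_mod ft (negbTE ng).
by move/good0P => /(_ i it); rewrite psum_shift; lra.
Qed.

Lemma sum_passages n u : (0 < n)%N ->
  ~ [/\ forall i, (i < n)%N -> u i <= 1, 1 <= psum u n
      & forall i, (i < n)%N -> u i \is a Num.int] ->
  (\sum_(k < n) passages n (shift n k u) <= 2 * n.-1)%N.
Proof.
move=> n0 nadm.
have f2 (k : 'I_n) : (passages n (shift n k u) <= 2)%N by exact: passages_le2.
have [le1|/existsNP[j /not_implyP[jn /negP]]] :=
    pselect (forall i, (i < n)%N -> u i <= 1); last first.
  rewrite -ltNge => uj.
  by apply: (@sum_le_two0 _ _ (Ordinal jn)) => //=; exact: rotation_gt1.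
have [un|un] := ltP (psum u n) 1.
  have [k kn fk] := rotation_lt1 n0 un.
  by apply: (@sum_le_two0 _ _ (Ordinal kn)).
have [ui|/existsNP[j /not_implyP[jn /negP uj]]] :=
    pselect (forall i, (i < n)%N -> u i \is a Num.int); first by case: nadm.
exact: rotation_nonint uj.
Qed.

(** Just before first reaching 1 or more, the sum is an integer below 1, hence at most 0; a step of
    at most 1 then lands exactly on 1. *)
Lemma int_passage n u : (0 < n)%N ->
  (forall i, (i < n)%N -> u i <= 1) -> 1 <= psum u n ->
  (forall i, (i < n)%N -> u i \is a Num.int) ->
  (\sum_(s < n) (psum u s.+1 == 1%R) * good s.+1 u = 1)%N.
Proof.
move=> n0 u1 un ui.
have ex : exists t, (t <= n)%N && (1 <= psum u t) by exists n; rewrite leqnn.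
case: (ex_minnP ex) => -[|t] /andP[tn ut] tmin.
  by move: ut; rewrite psum0 ler10.
have gt : good t.+1 u.
  apply/goodP => j jt; rewrite ltNge; apply/negP => uj.
  have := tmin j; rewrite uj (leq_trans (ltnW jt) tn) => /(_ isT).
  by rewrite leqNgt jt.
rewrite (@first_passage _ _ (fun s => good s u) t) ?gt //.
  by move=> s /negbTE ->.
have := u1 t tn; move/goodP: gt => /(_ t (ltnSn _)).
rewrite int_lt1 ?(psum_int ui) 1?ltnW // => H1 H2.
by move: ut; rewrite psumS; lra.
Qed.

End Sequences.

(** * Initial segments of a random order *)

Section RandomOrder.
Variable m : nat.
Notation n := m.+1.

Definition initial t : {set 'I_n} := [set i : 'I_n | (i < t)%N]%SET.

Lemma card_initial t : (t <= n)%N -> #|initial t| = t.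
Proof.
move=> tn; rewrite cardsE -sum1_card -[RHS]card_ord -[RHS]sum1_card.
by rewrite (big_ord_widen n (fun=> 1%N) tn).
Qed.

Lemma perm_initial (A : {set 'I_n}) :
  exists s : 'S_n, [set s i | i in initial #|A|]%SET = A.
Proof.
(* Listing [A] first and its complement afterwards gives the permutation. *)
set e := enum A ++ enum (~: A)%SET.
have se : size e = n by rewrite size_cat -!cardE cardsC card_ord.
have ue : uniq e.
  rewrite cat_uniq !enum_uniq andbT /=; apply/hasPn => x.
  by rewrite !mem_enum inE.
have finj : injective (fun i : 'I_n => nth ord0 e i).
  move=> i j /eqP; rewrite nth_uniq ?se ?ltn_ord // => /eqP; exact: val_inj.
exists (perm finj); apply/setP => x; apply/imsetP/idP => [[i]|xA].
  rewrite inE => iA ->; rewrite permE nth_cat -cardE iA.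
  by rewrite -mem_enum mem_nth -?cardE.
have xi : (index x (enum A) < #|A|)%N by rewrite cardE index_mem mem_enum.
have xn : (index x (enum A) < n)%N.
  by rewrite (leq_trans xi) // -[leqRHS]card_ord max_card.
exists (Ordinal xn); first by rewrite inE.
by rewrite permE /= nth_cat -cardE xi nth_index ?mem_enum.
Qed.

(** Composing with a permutation shows that the count is the same for all sets of this size, and
    these counts add up to the number of permutations. *)
Lemma count_perm_initial (A : {set 'I_n}) :
  ((\sum_(s : 'S_n) ([set s i | i in initial #|A|]%SET == A))
    * 'C(n, #|A|) = n`!)%N.
Proof.
set t := #|A|.
pose N B := (\sum_(s : 'S_n) ([set s i | i in initial t]%SET == B))%N.
have NE (B : {set 'I_n}) : #|B| = t -> N B = N (initial t).
  move=> Bt; have [r rB] := perm_initial B; rewrite Bt in rB.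
  rewrite /N (reindex_inj (mulIg r)) /=; apply: eq_bigr => s _.
  congr nat_of_bool; rewrite -{1}rB.
  have -> : [set (s * r)%g i | i in initial t]%SET =
      (r @: [set s i | i in initial t])%SET.
    by rewrite -imset_comp; apply: eq_imset => i; rewrite /= permM.
  by rewrite (inj_eq (imset_inj perm_inj)).
have tn : (t <= n)%N by rewrite /t -[leqRHS]card_ord max_card.
rewrite -/(N A) NE // mulnC.
have -> : ('C(n, t) = \sum_(B : {set 'I_n} | #|B| == t) 1)%N.
  by rewrite sum1_card -(card_ord n) -card_draws cardsE card_ord.
rewrite big_distrl /= (eq_bigr N) => [|B /eqP /NE ->]; last by rewrite mul1n.
rewrite exchange_big /= -card_Sn -sum1_card; apply: eq_bigr => s _.
rewrite (bigD1 [set s i | i in initial t]%SET) /=.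
  rewrite eqxx big1 // => B /andP[_ /negbTE]; by rewrite eq_sym => ->.
by rewrite card_imset ?card_initial //; exact: perm_inj.
Qed.

Lemma sum_perm_initial (R : numFieldType) (phi : {set 'I_n} -> R) t :
  (t <= n)%N ->
  \sum_(s : 'S_n) phi [set s i | i in initial t]%SET =
  (n`!)%:R * \sum_(A : {set 'I_n} | #|A| == t) phi A / 'C(n, t)%:R.
Proof.
move=> tn; rewrite (partition_big (fun s : 'S_n => [set s i | i in initial t]%SET)
  (fun A : {set 'I_n} => #|A| == t)) /=; last first.
  by move=> s _; rewrite card_imset ?card_initial //; exact: perm_inj.
rewrite mulr_sumr; apply: eq_bigr => A /eqP At.
rewrite (eq_bigr (fun=> phi A)) => [|s /eqP -> //].
rewrite sumr_const -sum1_card big_mkcond /=.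
have := count_perm_initial A; rewrite At => <-.
rewrite natrM mulrACA mulfV ?mulr1; last by rewrite pnatr_eq0 -lt0n bin_gt0.
rewrite -[LHS]mulr_natl; congr (_%:R * _); exact: eq_bigr.
Qed.

(** * The walk along a random order *)

Section Walk.
Variables (R : archiRealFieldType) (c : 'I_n -> R).

Definition walk (s : 'S_n) : nat -> R := fun i => c (s (inord i)).

Lemma psum_walk s t : (t <= n)%N ->
  psum (walk s) t = \sum_(i in [set s i | i in initial t]%SET) c i.
Proof.
move=> tn; rewrite big_imset /=; last by move=> i j _ _; exact: perm_inj.
rewrite /psum (big_ord_widen n (walk s) tn); apply: eq_big => i.
  by rewrite inE.
by rewrite /walk inord_val.
Qed.

Definition rotate_initial t k (i : 'I_n) : 'I_n :=
  if (i < t)%N then inord ((k + i) %% t) else i.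

Lemma rotate_initial_inj t k : (t <= n)%N -> injective (rotate_initial t k).
Proof.
move=> tn; have lt (i : 'I_n) : (i < t)%N -> ((k + i) %% t < t)%N.
  by move=> it; rewrite ltn_mod (leq_ltn_trans _ it).
move=> i j; rewrite /rotate_initial.
case: ifPn => it; case: ifPn => jt.
- move=> /(congr1 val); rewrite /= !inordK ?(leq_trans (lt _ _) tn) //.
  by move/eqP; rewrite eqn_modDl !modn_small // => /eqP /val_inj.
- move=> /(congr1 val); rewrite /= inordK ?(leq_trans (lt _ _) tn) // => e.
  by rewrite -e lt in jt.
- move=> /(congr1 val); rewrite /= inordK ?(leq_trans (lt _ _) tn) // => e.
  by rewrite e lt in it.
- by [].
Qed.

(** Rotating the first [t] entries permutes the orders, so all [t] rotations have the same total.
    [F] must depend on these entries only: beyond them the periodic [shift] differs from the rotated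
    walk. *)
Lemma sum_rotate t (F : (nat -> R) -> nat) : (t <= n)%N ->
  (forall u v, (forall i, (i < t)%N -> u i = v i) -> F u = F v) ->
  (t * \sum_(s : 'S_n) F (walk s) =
   \sum_(s : 'S_n) \sum_(k < t) F (shift t k (walk s)))%N.
Proof.
move=> tn Fext; rewrite exchange_big /=.
rewrite -[X in (X * _)%N]card_ord -sum_nat_const; apply: eq_bigr => k _.
rewrite (reindex_inj (mulgI (perm (@rotate_initial_inj t k tn)))) /=.
apply: eq_bigr => s _; apply: Fext => i it.
rewrite /walk /shift permM permE /rotate_initial inordK ?it //.
exact: leq_trans tn.
Qed.

Lemma eq_good t (u v : nat -> R) :
  (forall i, (i < t)%N -> u i = v i) -> good t u = good t v.
Proof.
move=> uv; apply: eq_forallb => j; rewrite (eq_psum (v := v)) // => i ij.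
by rewrite uv // (ltn_trans ij).
Qed.

Lemma eq_good0 t (u v : nat -> R) :
  (forall i, (i < t)%N -> u i = v i) -> good0 t u = good0 t v.
Proof.
move=> uv; apply: eq_forallb => j; rewrite (eq_psum (v := v)) // => i ij.
by rewrite uv // (ltn_trans ij).
Qed.

Lemma eq_passages (u v : nat -> R) :
  (forall i, (i < n)%N -> u i = v i) -> passages n u = passages n v.
Proof.
move=> uv; apply: eq_bigr => t _.
have tv i : (i < t.+1)%N -> u i = v i by move=> it; apply/uv/(leq_trans it).
by rewrite (eq_psum tv) (eq_good tv) (eq_good0 tv).
Qed.

(** Rotation inside the first [t] entries preserves a hit at [t], so [cycle_lemma] can be summed
    over all orders. *)
Lemma sum_hits t : (0 < t)%N -> (t <= n)%N ->
  (2 * \sum_(s : 'S_n) (psum (walk s) t == 1%R) <=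
   t * \sum_(s : 'S_n) (psum (walk s) t == 1%R)
                       * (good t (walk s) + good0 t (walk s)))%N.
Proof.
move=> t0 tn.
rewrite (sum_rotate (F := fun u => (psum u t == 1%R) * (good t u + good0 t u))%N tn).
  rewrite big_distrr /=; apply: leq_sum => s _.
  rewrite (eq_bigr (fun k : 'I_t => (psum (walk s) t == 1%R) *
    (good t (shift t k (walk s)) + good0 t (shift t k (walk s))))%N).
    rewrite -big_distrr /=; case: eqP => [/(cycle_lemma t0)|] //.
    by rewrite mul1n muln1.
  by move=> k _; rewrite psum_shift_period.
by move=> u v uv; rewrite (eq_psum uv) (eq_good uv) (eq_good0 uv).
Qed.

Lemma sum_hits_int t : (0 < t)%N -> (t <= n)%N ->
  (forall i, c i \is a Num.int) ->
  (\sum_(s : 'S_n) (psum (walk s) t == 1%R) =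
   t * \sum_(s : 'S_n) (psum (walk s) t == 1%R) * good t (walk s))%N.
Proof.
move=> t0 tn ci.
rewrite (sum_rotate (F := fun u => (psum u t == 1%R) * good t u)%N tn).
  apply: eq_bigr => s _.
  rewrite (eq_bigr (fun k : 'I_t =>
    (psum (walk s) t == 1%R) * good t (shift t k (walk s)))%N).
    rewrite -big_distrr /=; case: eqP => [ws|] //.
    by rewrite cycle_lemma_int // => i _; exact: ci.
  by move=> k _; rewrite psum_shift_period.
by move=> u v uv; rewrite (eq_psum uv) (eq_good uv).
Qed.

End Walk.
End RandomOrder.

(** * The weight as a sum over orders, and the conclusion *)

Definition indicator (R : realType) n (A : {set 'I_n}) : 'rV[R]_n :=
  \row_i (i \in A)%:R.

Lemma cube_indicator (R : realType) n :
  set_bij [set: {set 'I_n}] (cube R n) (@indicator R n).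
Proof.
split.
- by move=> A _ i; rewrite mxE; case: (i \in A); [right|left].
- move=> A B _ _ AB; apply/setP => i.
  have /rowP/(_ i) := AB; rewrite !mxE.
  by case: (i \in A); case: (i \in B) => // /eqP; rewrite ?oner_eq0 // eq_sym oner_eq0.
- move=> x xc; exists [set i | x 0 i == 1]%SET => //.
  apply/rowP => i; rewrite mxE inE.
  by case: (xc i) => ->; rewrite ?eqxx // eq_sym oner_eq0.
Qed.

Lemma weight_hyperplane (R : realType) m (c : 'rV[R]_m.+1) :
  weight (hyperplane c) * (m.+1`!)%:R =
  \sum_(t < m.+1) (t.+1)%:R^-1 *
    (\sum_(s : 'S_m.+1) (psum (walk (c 0%R) s) t.+1 == 1%R))%N%:R.
Proof.
pose phi (A : {set 'I_m.+1}) : R := (\sum_(i in A) c 0 i == 1)%:R.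
have -> : weight (hyperplane c) =
    \sum_(A : {set 'I_m.+1}) phi A * (#|A| * 'C(m.+1, #|A|))%:R^-1.
  rewrite /weight fsbig_mkcondl (reindex_fsbig _ _ _ _ (cube_indicator R m.+1)).
  rewrite (fsbigE (index_enum {set 'I_m.+1})) ?index_enum_uniq //; last first.
    by move=> A _; rewrite mem_index_enum.
  apply: eq_big => A; first by rewrite in_setT.
  move=> _; rewrite /phi.
  have -> : (indicator R A \in hyperplane c) = (\sum_(i in A) c 0 i == 1).
    have e : \sum_i c 0 i * indicator R A 0 i = \sum_(i in A) c 0 i.
      rewrite [RHS]big_mkcond; apply: eq_bigr => i _; rewrite mxE.
      by case: ifP; rewrite ?mulr1 ?mulr0.
    by apply/idP/eqP; rewrite inE /hyperplane /= e.
  case: eqP; rewrite ?mul0r // mul1r /point_weight => _.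
  suff -> : [set i | indicator R A 0 i == 1]%SET = A by [].
  apply/setP => i; rewrite inE mxE.
  by case: (i \in A); rewrite ?eqxx // eq_sym oner_eq0.
(* Group the vertices by size. Size 0 drops out because the empty sum is 0, not 1, so the default
   weight of the origin never matters. *)
rewrite (partition_big (fun A : {set 'I_m.+1} => inord #|A| : 'I_m.+2) predT) //=.
rewrite big_ord_recl big1 ?add0r; last first.
  move=> A /eqP /(congr1 val); rewrite /= inordK; last first.
    by rewrite ltnS -[leqRHS]card_ord max_card.
  by move=> /eqP; rewrite cards_eq0 => /eqP ->; rewrite /phi big_set0 eq_sym oner_eq0 mul0r.
rewrite mulr_suml; apply: eq_bigr => t _.
have tn : (t.+1 <= m.+1)%N by [].
have -> : (\sum_(s : 'S_m.+1) (psum (walk (c 0%R) s) t.+1 == 1%R))%N%:R =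
    \sum_(s : 'S_m.+1) phi [set s i | i in initial m t.+1]%SET.
  by rewrite natr_sum; apply: eq_bigr => s _; rewrite psum_walk.
rewrite sum_perm_initial // mulrCA mulrC; congr (_ * _).
rewrite mulr_sumr; apply: eq_big => [A|A /eqP].
  by rewrite -val_eqE /= inordK // ltnS -[leqRHS]card_ord max_card.
move=> /(congr1 val); rewrite /= inordK; last first.
  by rewrite ltnS -[leqRHS]card_ord max_card.
by rewrite /bump /= add1n => ->; rewrite natrM invfM mulrCA.
Qed.

Theorem theorem1p3 (R : realType) (n : nat) (c : 'rV[R]_n) :
  (1 <= n)%N -> c != 0 ->
  let admissible :=
    [/\ forall i, c 0 i <= 1,
        1 <= \sum_(i < n) c 0 i
      & forall i, c 0 i \is a Num.int] in
  (admissible -> weight (hyperplane c) = 1) /\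
  (~ admissible -> weight (hyperplane c) <= 1 - n%:R^-1).
Proof.
case: n c => // m c _ _ admissible.
have fact_gt0R : 0 < (m.+1`!)%:R :> R by rewrite ltr0n fact_gt0.
have psum_full s : psum (walk (c 0%R) s) m.+1 = \sum_(i < m.+1) c 0 i.
  rewrite psum_walk //; apply: eq_bigl => i; apply/imsetP.
  by exists ((s^-1)%g i); rewrite ?inE ?permKV.
split=> [[c1 cs ci]|nadm].
  apply: (mulIf (lt0r_neq0 fact_gt0R)); rewrite mul1r weight_hyperplane.
  rewrite (eq_bigr (fun t : 'I_m.+1 =>
    (\sum_(s : 'S_m.+1) (psum (walk (c 0%R) s) t.+1 == 1%R)
                        * good t.+1 (walk (c 0%R) s))%N%:R)); last first.
    move=> t _; rewrite sum_hits_int // natrM mulKf //.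
    by rewrite pnatr_eq0.
  rewrite -natr_sum exchange_big /=; congr (_%:R).
  rewrite (eq_bigr (fun=> 1%N)).
    by rewrite sum1_card card_Sn.
  move=> s _; apply: int_passage => //; last by move=> i _; exact: ci.
    by move=> i _; exact: c1.
  by rewrite psum_full.
(* Rotating the whole order, [t = n]: the [n] rotations of each order have at most [2 * m] passages,
   where [m = n - 1]. *)
have avg : (m.+1 * \sum_(s : 'S_m.+1) passages m.+1 (walk (c 0%R) s) <=
            m.+1`! * (2 * m))%N.
  rewrite (sum_rotate _ (leqnn _)); last by move=> u v; exact: eq_passages.
  rewrite -card_Sn -sum_nat_const; apply: leq_sum => s _.
  apply: (@sum_passages _ m.+1) => // -[w1 ws wi]; apply: nadm; split.
  - by move=> i; have := w1 (s^-1%g i) (ltn_ord _); rewrite /walk inord_val permKV.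
  - by rewrite -(psum_full s).
  - by move=> i; have := wi (s^-1%g i) (ltn_ord _); rewrite /walk inord_val permKV.
have hits : 2 * (weight (hyperplane c) * (m.+1`!)%:R) <=
    (\sum_(s : 'S_m.+1) passages m.+1 (walk (c 0%R) s))%N%:R.
  rewrite weight_hyperplane exchange_big /= natr_sum mulr_sumr; apply: ler_sum => t _.
  rewrite mulrCA ler_pdivrMl ?ltr0n // -!natrM ler_nat.
  exact: sum_hits.
have n0 : 0 < m.+1%:R :> R by rewrite ltr0n.
rewrite -(ler_pM2r fact_gt0R) -(ler_pM2l n0).
rewrite -(ler_nat R) natrM [X in _ <= X]natrM [(2 * m)%:R]natrM in avg.
have := ler_wpM2l (ltW n0) hits.
have -> : (1 - m.+1%:R^-1 : R) = m%:R / m.+1%:R.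
  apply: (mulIf (lt0r_neq0 n0)).
  by rewrite mulrBl mul1r mulVf ?divfK ?lt0r_neq0 // -natr1 addrK.
rewrite [_ * (m%:R / _ * _)]mulrA [m.+1%:R * (m%:R / _)]mulrC divfK ?lt0r_neq0 //.
by lra.
Qed.
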